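(* Let $(X,d)$ be a nonempty ultrametric space and let $D(X)=D(X,d)$ be the distance set of $(X,d)$. Then the following conditions are equivalent: (i) Every connected component of $\mathbb{R}^{+}\setminus D(X,d)$ is either open in $\mathbb{R}$ or a single-point set. (ii) For every $(Z,\delta)\in WS(X,d)$ and every weak similarity $\Phi\colon Z\to X$ of $(Z,\delta)$ and $(X,d)$ there is a strictly increasing ultrametric preserving function $g\colon\mathbb{R}^{+}\to\mathbb{R}^{+}$ such that $g|_{D(X,d)}=\psi$, where $\psi\colon D(X)\to D(Z)$ is the scaling function of $\Phi$.
   Context: $\mathbb{R}^{+}=[0,\infty)$. An ultrametric on a set $X$ is a metric $d\colon X\times X\to\mathbb{R}^{+}$ satisfying $d(x,y)\le\max\{d(x,z),d(z,y)\}$ for all $x,y,z\in X$. A function $f\colon\mathbb{R}^{+}\to\mathbb{R}^{+}$ is ultrametric preserving if $f\circ d$ is an ultrametric on $X$ for every ultrametric space $(X,d)$. For a metric space $(X,d)$, the distance set is $D(X)=D(X,d)=\{d(x,y)\colon x,y\in X\}$. For nonempty metric spaces $(Z,\delta)$ and $(X,d)$, a mapping $\Phi\colon Z\to X$ is a weak similarity of $(Z,\delta)$ and $(X,d)$ if $\Phi$ is bijective and there is a strictly increasing function $\psi\colon D(X)\to D(Z)$ such that $\delta(x,y)=\psi(d(\Phi(x),\Phi(y)))$ for all $x,y\in Z$. The function $\psi$ is uniquely determined by $\Phi$ and is called the scaling function of $\Phi$; the spaces are then called weakly similar. $WS(X,d)$ is the class of all ultrametric spaces weakly similar to $(X,d)$.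 $\mathbb{R}^{+}\setminus D(X)$ carries the subspace topology from $\mathbb{R}$; a component is a maximal connected subset. By convention the empty set is connected, and it is a component only of the empty space (so condition (i) holds if $D(X)=\mathbb{R}^{+}$). *)

(* Defs.v *)
From HB Require Import structures.
From mathcomp Require Import all_boot all_order all_algebra.
From mathcomp Require Import all_classical all_reals all_analysis.
Set Implicit Arguments.
Unset Strict Implicit.
Unset Printing Implicit Defensive.
Import Order.TTheory GRing.Theory Num.Theory.
Import numFieldNormedType.Exports.
Local Open Scope classical_set_scope.
Local Open Scope ring_scope.

Definition is_metric (R : realType) (X : Type) (d : X -> X -> R) : Prop :=
  [/\ forall x y, 0 <= d x y,
      forall x y, d x y = 0 <-> x = y,
      forall x y, d x y = d y x &
      forall x y z, d x y <= d x z + d z y].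

Definition is_ultrametric (R : realType) (X : Type) (d : X -> X -> R) : Prop :=
  is_metric d /\ forall x y z, d x y <= Num.max (d x z) (d z y).

Definition Rplus (R : realType) : set R := `[0, +oo[.

(* A map between subsets A and B of R is represented by a total f : R -> R
   such that [set_fun A B f]; only the values of f on A are relevant. *)
Definition strictly_increasing_on (R : realType) (A : set R) (f : R -> R) : Prop :=
  forall s t, A s -> A t -> s < t -> f s < f t.

Definition ultrametric_preserving (R : realType) (f : R -> R) : Prop :=
  set_fun (@Rplus R) (@Rplus R) f /\
  forall (X : Type) (d : X -> X -> R),
    is_ultrametric d -> is_ultrametric (fun x y => f (d x y)).

Definition distance_set (R : realType) (X : Type) (d : X -> X -> R) : set R :=
  [set t | exists x y, d x y = t].

(* This determines the values of psi on [distance_set d] uniquely when Phi is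
   surjective; the values elsewhere are unconstrained. *)
Definition is_scaling_function (R : realType) (Z X : Type)
    (delta : Z -> Z -> R) (d : X -> X -> R) (Phi : Z -> X) (psi : R -> R) : Prop :=
  [/\ set_fun (distance_set d) (distance_set delta) psi,
      strictly_increasing_on (distance_set d) psi &
      forall x y, delta x y = psi (d (Phi x) (Phi y))].

Definition weak_similarity (R : realType) (Z X : Type)
    (delta : Z -> Z -> R) (d : X -> X -> R) (Phi : Z -> X) : Prop :=
  bijective Phi /\ exists psi, is_scaling_function delta d Phi psi.

(* [WS d delta] : (Z, delta) belongs to the class WS(X, d). *)
Definition WS (R : realType) (X : Type) (d : X -> X -> R)
    (Z : Type) (delta : Z -> Z -> R) : Prop :=
  is_ultrametric delta /\ exists Phi : Z -> X, weak_similarity delta d Phi.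

(* Maximal connected subset of A; [connected] on sets is connectedness for the
   subspace topology.  As [connected set0] holds, set0 is a component of A
   exactly when A = set0. *)
Definition is_component (T : topologicalType) (A C : set T) : Prop :=
  [/\ C `<=` A, connected C &
      forall C' : set T, C' `<=` A -> connected C' -> C `<=` C' -> C' = C].

(* Main.v *)
(* A strictly increasing function fixing 0 turns ultrametrics into ultrametrics,
   so scaling functions are exactly the strictly increasing [psi] on [D = D(X)]
   with [psi 0 = 0], and (ii) says that each of them extends to a strictly
   increasing function on [0, +oo[.
   Under (i), a point off [D] lies in a gap ]a, b[ or ]a, +oo[ with end points
   in [D], where [psi] is extended affinely, or is a two-sided limit of [D],
   where the supremum of the values on its left is taken.
   Conversely, let a component have more than one point and not be open.  If it
   is bounded with end points a < b, these are not both in [D], and translating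
   the part of [D] above the gap by a - b remains strictly increasing, but forces
   g b <= a <= g a.  If it is [a, +oo[, then t / (a - t) is unbounded on [D],
   and [g a] cannot exist. *)
Require Import Defs.
From mathcomp Require Import all_boot all_order all_algebra.
From mathcomp Require Import all_classical all_reals all_analysis.
From mathcomp Require Import lra.
Import Order.TTheory GRing.Theory Num.Theory.
Import numFieldNormedType.Exports.
Local Open Scope classical_set_scope.
Local Open Scope ring_scope.

(** Monotonicity on [D] carries the strong triangle inequality over, and the ordinary one follows
    because a maximum of nonnegative numbers is at most their sum. The set [D] is a parameter so
    that the lemma serves both a scaling function on the distance set and its extension on
    [Rplus]. *)
Lemma increasing_ultrametric (R : realType) (X : Type) (d : X -> X -> R)
    (D : set R) (f : R -> R) :
  is_ultrametric d -> (forall x y, D (d x y)) -> D 0 -> f 0 = 0 ->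
  strictly_increasing_on D f -> is_ultrametric (fun x y => f (d x y)).
Proof.
move=> [[d_ge0 d_eq0 d_sym _] d_ultra] Dd D0 f0 f_incr.
have f_gt0 s : D s -> 0 < s -> 0 < f s by move=> Ds s0; rewrite -f0; exact: f_incr.
have f_ge0 x y : 0 <= f (d x y).
  have := d_ge0 x y; rewrite le_eqVlt => /orP[/eqP <-|dxy]; first by rewrite f0.
  exact/ltW/f_gt0.
have f_mono s t : D s -> D t -> s <= t -> f s <= f t.
  by move=> Ds Dt; rewrite le_eqVlt => /orP[/eqP -> //|st]; exact/ltW/f_incr.
have ultra x y z : f (d x y) <= Num.max (f (d x z)) (f (d z y)).
  have := d_ultra x y z; rewrite !le_max => /orP[|] h.
    by rewrite f_mono.
  by rewrite (f_mono _ (d z y)) ?orbT.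
split=> //; split=> // [x y|x y|x y z].
- rewrite -d_eq0; split=> [fxy|->//].
  apply/eqP; rewrite eq_le d_ge0 andbT leNgt; apply/negP => dxy.
  by have := f_gt0 _ (Dd x y) dxy; rewrite fxy ltxx.
- by rewrite d_sym.
- apply: le_trans (ultra x y z) _.
  by rewrite ge_max lerDl lerDr !f_ge0.
Qed.

Lemma connected_component_is_component (T : topologicalType) (A : set T) (x : T) :
  A x -> is_component A (connected_component A x).
Proof.
move=> Ax; split; [exact: connected_component_sub|exact: component_connected|].
move=> C CA C_conn subC; apply/seteqP; split=> //.
exact: connected_component_max (subC _ (connected_component_refl Ax)) CA C_conn.
Qed.

(** * Components of the complement of [D] in the half-line, and their end points *)

Section Components.
Context {R : realType} {D C : set R}.
Hypothesis C_comp : is_component (@Rplus R `\` D) C.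

Lemma component_ge0 x : C x -> 0 <= x.
Proof. by case: C_comp => CA _ _ /CA[]; rewrite /Rplus /= in_itv /= andbT. Qed.

Lemma component_notin x : C x -> ~ D x.
Proof. by case: C_comp => CA _ _ /CA[]. Qed.

Lemma component_itv : is_interval C.
Proof. by case: C_comp => _ /connected_intervalP. Qed.

(** The segment joining [x] and [y] meets [C] and misses [D], so its union with [C] is still
    connected and maximality absorbs it. All later statements that a component would grow go through
    this lemma. *)
Lemma component_segment x y : C x -> 0 <= y ->
  (forall z, Num.min x y <= z <= Num.max x y -> ~ D z) -> C y.
Proof.
move=> Cx y0 nD; have x0 := component_ge0 _ Cx.
have [CA C_conn C_max] := C_comp.
have xE : Num.min x y <= x <= Num.max x y by rewrite ge_min le_max !lexx.
have yE : Num.min x y <= y <= Num.max x y by rewrite ge_min le_max !lexx !orbT.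
rewrite -(C_max (C `|` `[Num.min x y, Num.max x y])).
- by right; rewrite /= in_itv.
- move=> z [/CA//|]; rewrite /= in_itv /= => zE; split; last exact: nD.
  rewrite /Rplus /= in_itv /= andbT.
  by case/andP: zE => + _; apply: le_trans; rewrite le_min x0.
- apply: connectedU => //; last exact: segment_connected.
  by exists x; split=> //=; rewrite in_itv.
- by move=> z; left.
Qed.

Lemma component_lbound : has_lbound C.
Proof. by exists 0 => x; exact: component_ge0. Qed.

Lemma inf_component_ge0 t : C t -> 0 <= inf C.
Proof. by move=> Ct; apply: lb_le_inf; [exists t|move=> x; exact: component_ge0]. Qed.

Lemma component_gt_inf t z : C t -> inf C < z <= t -> C z.
Proof.
move=> Ct /andP[az zt].
have [u Cu uz] : exists2 u, C u & u < inf C + (z - inf C).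
  by apply: inf_adherent; rewrite ?subr_gt0//; split; [exists t|exact: component_lbound].
by apply: component_itv Cu Ct _ _; rewrite zt andbT; lra.
Qed.

Lemma component_lt_sup t z : has_ubound C -> C t -> t <= z < sup C -> C z.
Proof.
move=> ubC Ct /andP[tz zb].
have [u Cu uz] : exists2 u, C u & sup C - (sup C - z) < u.
  by apply: sup_adherent; rewrite ?subr_gt0//; split=> //; exists t.
by apply: component_itv Ct Cu _ _; rewrite tz /=; lra.
Qed.

Lemma inf_component t : C t -> ~ D (inf C) -> C (inf C).
Proof.
move=> Ct nD; have at_ : inf C <= t by apply: ge_inf => //; exact: component_lbound.
apply: (component_segment _ _ Ct); first exact: inf_component_ge0 Ct.
move=> z; rewrite min_r// max_l// le_eqVlt andb_orl => /orP[/andP[/eqP <-]//|azt].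
exact/component_notin/(component_gt_inf _ _ Ct).
Qed.

Lemma sup_component t : has_ubound C -> C t -> ~ D (sup C) -> C (sup C).
Proof.
move=> ubC Ct nD; have tb : t <= sup C by exact: ub_le_sup.
apply: (component_segment _ _ Ct); first exact: le_trans (component_ge0 _ Ct) tb.
move=> z; rewrite min_l// max_r// [z <= _]le_eqVlt andb_orr.
move=> /orP[/andP[_ /eqP ->]//|tzb].
exact/component_notin/(component_lt_sup _ _ ubC Ct).
Qed.

(** If [D] missed the interval from [s] to [inf C], the component could be prolonged below its
    infimum. When [inf C = 0] there is no room for this, and [0] itself is the required point of
    [D]. *)
Lemma inf_component_adherent t s : D 0 -> C t -> s < inf C ->
  exists2 u, D u & s < u <= inf C.
Proof.
move=> D0 Ct sa; have a0 := inf_component_ge0 _ Ct.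
apply: contrapT => nD.
have {}nD z : s < z <= inf C -> ~ D z by move=> zE Dz; apply: nD; exists z.
have a_gt0 : 0 < inf C.
  rewrite lt_neqAle a0 andbT; apply/eqP => aE.
  by apply: (nD 0) => //; rewrite [in X in _ && X]aE lexx andbT aE.
have at_ : inf C <= t by apply: ge_inf => //; exact: component_lbound.
(* The maximum with [0] keeps the prolongation inside the half-line, as [s] may be negative. *)
pose y := (Num.max s 0 + inf C) / 2.
have [y0 sy ya] : [/\ 0 <= y, s < y & y < inf C] by rewrite /y; case: (ltP s 0) => ?; split; lra.
suff Cy : C y by have := ge_inf component_lbound Cy; rewrite leNgt ya.
apply: (component_segment _ _ Ct) => // z.
rewrite min_r ?max_l; try by apply: le_trans at_; exact: ltW.
move=> /andP[yz zt]; have [za|az] := leP z (inf C).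
  by apply: nD; rewrite za andbT; exact: lt_le_trans yz.
by apply/component_notin/(component_gt_inf _ _ Ct); rewrite az.
Qed.

Lemma sup_component_adherent t s : has_ubound C -> C t -> sup C < s ->
  exists2 u, D u & sup C <= u < s.
Proof.
move=> ubC Ct bs; have tb : t <= sup C by exact: ub_le_sup.
apply: contrapT => nD.
have {}nD z : sup C <= z < s -> ~ D z by move=> zE Dz; apply: nD; exists z.
pose y := (sup C + s) / 2.
have [yb ys] : sup C < y /\ y < s by rewrite /y; split; lra.
suff Cy : C y by have := ub_le_sup ubC Cy; rewrite leNgt yb.
have ty : t <= y by apply: le_trans tb _; exact: ltW.
apply: (component_segment _ _ Ct); first exact: le_trans (component_ge0 _ Ct) ty.
move=> z; rewrite min_l// max_r// => /andP[tz zy]; have [bz|zb] := leP (sup C) z.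
  by apply: nD; rewrite bz /=; exact: le_lt_trans ys.
by apply/component_notin/(component_lt_sup _ _ ubC Ct); rewrite tz.
Qed.

End Components.

(** * Extending an increasing function from [D] to the half-line *)

Inductive extension_value {R : realType} (D : set R) (psi : R -> R) (t : R) :
    R -> Prop :=
| value_in_set of D t : extension_value D psi t (psi t)
| value_in_gap a b of D a & D b & a < t < b
    & (forall u, D u -> a < u < b -> False) :
    extension_value D psi t (psi a + (psi b - psi a) * ((t - a) / (b - a)))
| value_above_set a of D a & a < t & (forall u, D u -> u <= a) :
    extension_value D psi t (psi a + (t - a))
| value_at_limit y of ~ D t
    & (forall s, 0 <= s -> s < t -> exists2 u, D u & s < u < t)
    & (forall s, t < s -> exists2 u, D u & t < u < s)
    & (forall u, D u -> u < t -> psi u <= y)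
    & (forall u, D u -> t < u -> y <= psi u) : extension_value D psi t y.

Section Extension.
Context {R : realType} {D : set R} {psi : R -> R}.
Hypothesis D_ge0 : D `<=` @Rplus R.
Hypothesis psi_incr : strictly_increasing_on D psi.

Let D_nonneg u : D u -> 0 <= u.
Proof. by move=> /D_ge0; rewrite /Rplus /= in_itv /= andbT. Qed.

Let psi_mono s t : D s -> D t -> s <= t -> psi s <= psi t.
Proof. by move=> Ds Dt; rewrite le_eqVlt => /orP[/eqP -> //|]; move/psi_incr => /(_ Ds Dt)/ltW. Qed.

Let interpolation_bounds a b t : D a -> D b -> a < t < b ->
  psi a < psi a + (psi b - psi a) * ((t - a) / (b - a)) < psi b.
Proof.
move=> Da Db /andP[a_t tb]; have := psi_incr _ _ Da Db (lt_trans a_t tb).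
have : 0 < (t - a) / (b - a) < 1.
  by rewrite divr_gt0 ?ltr_pdivrMr ?mul1r /= ?subr_gt0 //; lra.
move: (_ / _) => q; nra.
Qed.

(** Strictness at a limit point comes from a further point of [D] between [u] and [t]; in a gap, [u]
    is at most the left end point. *)
Lemma extension_value_gt t y u :
  extension_value D psi t y -> D u -> u < t -> psi u < y.
Proof.
case=> [Dt Du|a b Da Db atb gap Du ut|a Da a_t above Du ut|z nDt lim _ lo _ Du ut].
- exact: psi_incr.
- have /andP[+ _] := interpolation_bounds _ _ _ Da Db atb; apply: le_lt_trans.
  apply: psi_mono => //; rewrite leNgt; apply/negP => au; apply: (gap u) => //.
  by rewrite au (lt_trans ut)//; case/andP: atb.
- by have := psi_mono _ _ Du Da (above _ Du); lra.
- have [v Dv /andP[uv vt]] := lim _ (D_nonneg _ Du) ut.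
  exact: lt_le_trans (psi_incr _ _ Du Dv uv) (lo _ Dv vt).
Qed.

Lemma extension_value_lt t y u :
  extension_value D psi t y -> D u -> t < u -> y < psi u.
Proof.
case=> [Dt Du|a b Da Db atb gap Du tu|a Da a_t above Du tu|z nDt _ lim _ hi Du tu].
- exact: psi_incr.
- have /andP[_ +] := interpolation_bounds _ _ _ Da Db atb; move=> /lt_le_trans; apply.
  apply: psi_mono => //; rewrite leNgt; apply/negP => ub; apply: (gap u) => //.
  by rewrite ub andbT; case/andP: atb => a_t _; exact: lt_trans tu.
- by have := above _ Du; lra.
- have [v Dv /andP[tv vu]] := lim _ tu.
  exact: le_lt_trans (hi _ Dv tv) (psi_incr _ _ Dv Du vu).
Qed.

Lemma extension_value_in t y : extension_value D psi t y -> D t -> y = psi t.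
Proof.
case=> // [a b _ _ atb gap Dt|a _ a_t above Dt]; first by case: (gap t).
by have := above _ Dt; rewrite leNgt a_t.
Qed.

(** A point of [D] in the segment from [s] to [t] separates the two values. Without one, limit
    points are ruled out and [s], [t] share a gap, on which the extension is affine with positive
    slope. *)
Lemma extension_value_increasing s t y z : 0 <= s -> s < t ->
  extension_value D psi s y -> extension_value D psi t z -> y < z.
Proof.
move=> s0 st ys zt.
have [[u Du /andP[su ut]]|nD] := pselect (exists2 u, D u & s <= u <= t).
  have [su'|us] := ltP s u.
    have yu := extension_value_lt _ _ _ ys Du su'; apply: lt_le_trans yu _.
    move: ut; rewrite le_eqVlt => /orP[/eqP ut|]; last by move=> /(extension_value_gt _ _ _ zt Du)/ltW.
    by rewrite (extension_value_in _ _ zt) -ut.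
  have {us su}us : s = u by apply/eqP; rewrite eq_le su.
  rewrite (extension_value_in _ _ ys) us//.
  by apply: extension_value_gt zt Du _; rewrite -us.
have {}nD u : D u -> u < s \/ t < u.
  move=> Du; have [us|su] := ltP u s; first by left.
  by right; rewrite ltNge; apply/negP => ut; apply: nD; exists u; rewrite ?su.
case: ys => [Ds|a b Da Db /andP[as_ sb] gap|a Da as_ above|{}y _ _ lim _ _].
- by case: (nD _ Ds); lra.
- have tb : t < b by case: (nD _ Db) => //; lra.
  case: zt => [Dt|a' b' Da' Db' /andP[a't tb'] gap'|a' Da' a't above|{}z _ lim _ _ _].
  + by case: (nD _ Dt); lra.
  (* Both gaps contain [s] and [t], so an end point of one that differed from that of the other
     would lie inside a gap. *)
  + have a's : a' < s by case: (nD _ Da') => //; lra.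
    have sb' : s < b' by lra.
    have aa' : a' = a.
      apply/eqP; rewrite eq_le !leNgt; apply/andP; split; apply/negP => h.
        by apply: (gap a') => //; lra.
      by apply: (gap' a) => //; lra.
    have bb' : b' = b.
      apply/eqP; rewrite eq_le !leNgt; apply/andP; split; apply/negP => h.
        by apply: (gap' b) => //; lra.
      by apply: (gap b') => //; lra.
    have ab : a < b by lra.
    rewrite aa' bb' ltrD2l ltr_pM2l ?subr_gt0; last exact: psi_incr.
    by rewrite ltr_pM2r ?invr_gt0 ?subr_gt0// ltrD2r.
  + by have := above _ Db; lra.
  + by have [u Du] := lim _ s0 st; case: (nD _ Du); lra.
- case: zt => [Dt|a' b' Da' Db' /andP[a't tb'] gap'|a' Da' a't above'|{}z _ lim _ _ _].
  + by case: (nD _ Dt); lra.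
  + by have := above _ Db'; lra.
  + have -> : a' = a by apply/eqP; rewrite eq_le above// above'.
    by lra.
  + by have [u Du] := lim _ s0 st; case: (nD _ Du); lra.
- by have [u Du] := lim _ st; case: (nD _ Du); lra.
Qed.

Hypothesis D0 : D 0.
Hypothesis components : forall C : set R, is_component (@Rplus R `\` D) C ->
  open C \/ exists a : R, C = [set a].

Lemma extension_value_exists t : 0 <= t -> exists y, extension_value D psi t y.
Proof.
move=> t0; have [Dt|nDt] := pselect (D t); first by exists (psi t); exact: value_in_set.
have At : (@Rplus R `\` D) t by split=> //; rewrite /Rplus /= in_itv /= t0.
have C_comp := connected_component_is_component _ _ _ At.
have Ct := connected_component_refl At.
move: (connected_component _ _) C_comp Ct => C C_comp Ct.
have [/interior_id C_open|[c CE]] := components _ C_comp.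
(* An open interval equals its interior and thus omits its end points; a finite end point outside
   [D] would belong to [C], so the finite end points are in [D]. *)
- have nCa : ~ C (inf C).
    have [ubC|nubC] := pselect (has_ubound C).
      rewrite -{1}C_open interval_bounded_interior ?ltxx//=.
      - by rewrite ltxx.
      - exact: component_itv C_comp.
      - exact: component_lbound C_comp.
    rewrite -{1}C_open interval_right_unbounded_interior//=.
    - by rewrite ltxx.
    - exact: component_itv C_comp.
    - exact: component_lbound C_comp.
  have Da : D (inf C) by apply: contrapT => /(inf_component C_comp _ Ct).
  have a_t : inf C < t.
    rewrite lt_neqAle ge_inf ?andbT//; last exact: component_lbound C_comp.
    by apply/eqP => E; apply: nDt; rewrite -E.
  have [ubC|nubC] := pselect (has_ubound C).
    have CE : C = [set r | inf C < r < sup C].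
      rewrite -{1}C_open interval_bounded_interior//; last exact: component_lbound C_comp.
      exact: component_itv C_comp.
    have Db : D (sup C).
      apply: contrapT => /(sup_component C_comp _ ubC Ct).
      by rewrite {1}CE /= ltxx andbF.
    eexists; apply: (value_in_gap _ _ _ (inf C) (sup C)) => //.
      by move: Ct; rewrite {1}CE.
    move=> u Du uC; apply: (component_notin C_comp u) => //.
    by rewrite CE.
  have CE : C = [set r | inf C < r].
    rewrite -{1}C_open interval_right_unbounded_interior//; last exact: component_lbound C_comp.
    exact: component_itv C_comp.
  eexists; apply: (value_above_set _ _ _ (inf C)) => // u Du.
  rewrite leNgt; apply/negP => au; apply: (component_notin C_comp u) => //.
  by rewrite CE.
- have ct : c = t by move: Ct; rewrite CE.
  move: ct CE => {c}-> CE.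
  (* If [D] had no point between [s] and [t], the midpoint would join the component, which is
     reduced to [t]. *)
  have left_lim s : 0 <= s -> s < t -> exists2 u, D u & s < u < t.
    move=> s0 st; apply: contrapT => nD.
    pose y := (s + t) / 2.
    have [y0 sy yt] : [/\ 0 <= y, s < y & y < t] by rewrite /y; split; lra.
    suff : C y by rewrite CE /= => yE; lra.
    apply: (component_segment C_comp _ _ Ct) => // z.
    rewrite min_r ?max_l; try exact: ltW.
    move=> /andP[yz]; rewrite le_eqVlt => /orP[/eqP -> //|zt] Dz.
    by apply: nD; exists z => //; lra.
  have right_lim s : t < s -> exists2 u, D u & t < u < s.
    move=> ts; apply: contrapT => nD.
    pose y := (s + t) / 2.
    have [y0 ty ys] : [/\ 0 <= y, t < y & y < s] by rewrite /y; split; lra.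
    suff : C y by rewrite CE /= => yE; lra.
    apply: (component_segment C_comp _ _ Ct) => // z.
    rewrite min_l ?max_r; try exact: ltW.
    move=> /andP[+ zy]; rewrite le_eqVlt => /orP[/eqP <- //|tz] Dz.
    by apply: nD; exists z => //; lra.
  pose E := psi @` [set u | D u /\ u < t].
  have E0 : E !=set0.
    exists (psi 0), 0 => //; split=> //.
    by rewrite lt_neqAle t0 andbT; apply/eqP => t0'; apply: nDt; rewrite -t0'.
  have ubE u : D u -> t < u -> ubound E (psi u).
    by move=> Du tu _ [v [Dv vt] <-]; apply/ltW/psi_incr => //; exact: lt_trans tu.
  exists (sup E); apply: value_at_limit => // [u Du ut|u Du tu].
    (* Any point of [D] above [t] bounds [E]; the [1] is arbitrary. *)
    have [v Dv /andP[tv _]] := right_lim (t + 1) ltac:(lra).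
    by apply: ub_le_sup; [exists (psi v); exact: ubE|exists u].
  exact: ge_sup E0 (ubE _ Du tu).
Qed.

Lemma increasing_extension : exists g : R -> R,
  strictly_increasing_on (@Rplus R) g /\ forall t, D t -> g t = psi t.
Proof.
have /choice[g gP] : forall t, exists y, 0 <= t -> extension_value D psi t y.
  move=> t; have [t0|_] := leP 0 t; last by exists 0.
  by have [y yt] := extension_value_exists _ t0; exists y.
exists g; split=> [s t|t Dt]; last first.
  by apply: extension_value_in => //; exact/gP/D_nonneg.
rewrite /Rplus /= !in_itv /= !andbT => s0 t0 st.
exact: extension_value_increasing s0 st (gP _ s0) (gP _ t0).
Qed.

End Extension.

(** * Extendability forces components to be open or singletons *)

Section NonExtension.
Context {R : realType} {D C : set R}.
Hypothesis D_ge0 : D `<=` @Rplus R.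
Hypothesis D0 : D 0.
Hypothesis extendable : forall psi : R -> R, psi 0 = 0 ->
  strictly_increasing_on D psi -> exists g : R -> R,
  strictly_increasing_on (@Rplus R) g /\ forall t, D t -> g t = psi t.
Hypothesis C_comp : is_component (@Rplus R `\` D) C.

Let increasing_le (g : R -> R) (s t : R) : strictly_increasing_on (@Rplus R) g ->
  0 <= s -> s <= t -> g s <= g t.
Proof.
move=> g_incr s0; rewrite le_eqVlt => /orP[/eqP -> //|st].
by apply/ltW/g_incr => //; rewrite /Rplus /= in_itv /= andbT // (le_trans s0)// ltW.
Qed.

Let D_nonneg u : D u -> 0 <= u.
Proof. by move=> /D_ge0; rewrite /Rplus /= in_itv /= andbT. Qed.

Lemma bounded_component_open x y : has_ubound C -> C x -> C y -> x < y -> open C.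
Proof.
move=> ubC Cx Cy xy.
have lbC := component_lbound C_comp.
have Cint := interval_bounded_interior (component_itv C_comp) lbC ubC.
have ax := ge_inf lbC Cx; have yb := ub_le_sup ubC Cy.
have a0 := inf_component_ge0 C_comp _ Cx.
have gap u : D u -> inf C < u -> sup C <= u.
  move=> Du au; rewrite leNgt; apply/negP => ub.
  apply: (component_notin C_comp u) => //.
  by apply: interior_subset; rewrite Cint /= au.
apply: contrapT => nopen.
(* With both end points in [D], the component would omit them and be open. *)
have nDD : ~ (D (inf C) /\ D (sup C)).
  case=> Da Db; apply: nopen; apply/interior_id/seteqP; split; first exact: interior_subset.
  move=> z Cz; rewrite Cint /= !lt_neqAle (ge_inf lbC Cz) (ub_le_sup ubC Cz) !andbT.
  by apply/andP; split; apply/eqP => E; apply: (component_notin C_comp z) => //;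
    [rewrite -E|rewrite E].
(* Closing up the gap glues both ends of [C] together, leaving no room for the
   images of its points. *)
pose psi t := if t <= inf C then t else t - (sup C - inf C).
have psi0 : psi 0 = 0 by rewrite /psi a0.
have psi_incr : strictly_increasing_on D psi.
  move=> s t Ds Dt st; rewrite /psi; case: (leP s) => sa; case: (leP t) => ta //; try lra.
  have bt := gap _ Dt ta.
  (* Strictness could fail only for [s = inf C] and [t = sup C], which are not both in [D]. *)
  have [sE|sE] := eqVneq s (inf C); last by move: sE; rewrite neq_lt => /orP[]; lra.
  have [tE|tE] := eqVneq t (sup C); last by move: tE; rewrite neq_lt => /orP[]; lra.
  by case: nDD; rewrite -sE -tE.
have [g [g_incr gE]] := extendable _ psi0 psi_incr.
(* Points of [D] arbitrarily close to [inf C] from the left, or [inf C] itself, are fixed by [psi]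
   and bound [g (inf C)] from below. *)
have ga : inf C <= g (inf C).
  rewrite leNgt; apply/negP => h.
  have [u Du /andP[gu ua]] := inf_component_adherent C_comp _ _ D0 Cx h.
  have := increasing_le _ _ _ g_incr (D_nonneg _ Du) ua.
  by rewrite gE// /psi ua; lra.
(* Points of [D] close to [sup C] from the right are sent by [psi] close to [inf C]. *)
have gb : g (sup C) <= inf C.
  rewrite leNgt; apply/negP => h.
  have [|u Du /andP[bu ug]] := sup_component_adherent C_comp x
      (sup C + (g (sup C) - inf C)) ubC Cx; first lra.
  have b0 : 0 <= sup C by lra.
  have := increasing_le _ _ _ g_incr b0 bu.
  have au : inf C < u by lra.
  by rewrite (gE _ Du) /psi (leNgt u) au /=; lra.
have : g (inf C) < g (sup C).
  by apply: g_incr; rewrite ?/Rplus /= ?in_itv /= ?andbT; lra.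
by lra.
Qed.

Lemma unbounded_component_open x : ~ has_ubound C -> C x -> open C.
Proof.
move=> nubC Cx.
have lbC := component_lbound C_comp.
have Cint := interval_right_unbounded_interior (component_itv C_comp) lbC nubC.
have a0 := inf_component_ge0 C_comp _ Cx.
apply: contrapT => nopen.
have nDa : ~ D (inf C).
  move=> Da; apply: nopen; apply/interior_id/seteqP; split; first exact: interior_subset.
  move=> z Cz; rewrite Cint /= lt_neqAle (ge_inf lbC Cz) andbT.
  by apply/eqP => E; apply: (component_notin C_comp z) => //; rewrite -E.
have D_lt u : D u -> u < inf C.
  move=> Du; rewrite lt_neqAle; apply/andP; split.
    by apply/eqP => E; apply: nDa; rewrite -E.
  rewrite leNgt; apply/negP => au; apply: (component_notin C_comp u) => //.
  by apply: interior_subset; rewrite Cint.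
have a_gt0 := D_lt _ D0.
(* [psi] blows up at [inf C], which is a limit of [D], so that no value of an
   extension at [inf C] is large enough. *)
pose psi t := t / (inf C - t).
have psi0 : psi 0 = 0 by rewrite /psi mul0r.
have psi_incr : strictly_increasing_on D psi.
  move=> s t Ds Dt st; have := D_lt _ Ds; have := D_lt _ Dt => ta sa.
  by rewrite /psi ltr_pdivrMr ?subr_gt0// mulrAC ltr_pdivlMr ?subr_gt0//; nra.
have [g [g_incr gE]] := extendable _ psi0 psi_incr.
have M0 : 0 < g (inf C).
  rewrite -psi0 -gE//; apply: g_incr => //; rewrite /Rplus /= in_itv /= ?lexx//.
  by rewrite a0.
(* The threshold solves [psi t = g (inf C)], so a point [u] of [D] beyond it has [psi u] larger than
   [g (inf C)], although [u <= inf C]. *)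
have [|u Du /andP[su ua]] := inf_component_adherent C_comp x
    (inf C * g (inf C) / (1 + g (inf C))) D0 Cx.
  by rewrite ltr_pdivrMr; nra.
have := increasing_le _ _ _ g_incr (D_nonneg _ Du) ua.
rewrite gE// /psi ler_pdivrMr ?subr_gt0 ?D_lt//.
by move: su; rewrite ltr_pdivrMr; nra.
Qed.

Lemma component_open_or_singleton : open C \/ exists a : R, C = [set a].
Proof.
have [[x Cx]|C0] := pselect (C !=set0); last first.
  left; have -> : C = set0 by apply/eqP/negP => /negP/set0P.
  exact: open0.
have [ubC|nubC] := pselect (has_ubound C); last first.
  by left; exact: unbounded_component_open nubC Cx.
have [[y Cy yx]|single] := pselect (exists2 y, C y & y != x); last first.
  right; exists x; apply/seteqP; split=> [y Cy|_ ->//] /=.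
  by apply: contrapT => /eqP yx; apply: single; exists y.
left; move: yx; rewrite neq_lt => /orP[yx|xy].
  exact: bounded_component_open ubC Cy Cx yx.
exact: bounded_component_open ubC Cx Cy xy.
Qed.

End NonExtension.

(** * The equivalence *)

Theorem theorem2p14 (R : realType) (X : Type) (d : X -> X -> R)
  (X_nonempty : inhabited X) (d_ultrametric : is_ultrametric d) :
  (forall C : set R, is_component (@Rplus R `\` distance_set d) C ->
     open C \/ exists a : R, C = [set a])
  <->
  (forall (Z : Type) (delta : Z -> Z -> R), WS d delta ->
   forall Phi : Z -> X, weak_similarity delta d Phi ->
   forall psi : R -> R, is_scaling_function delta d Phi psi ->
   exists g : R -> R,
     [/\ strictly_increasing_on (@Rplus R) g,
         ultrametric_preserving g &
         forall t, distance_set d t -> g t = psi t]).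
Proof.
have [x0] := X_nonempty.
have [[d_ge0 d_eq0 _ _] _] := d_ultrametric.
have d0 x : d x x = 0 by apply/d_eq0.
have D0 : distance_set d 0 by exists x0, x0.
have D_ge0 : distance_set d `<=` @Rplus R.
  by move=> _ [x [y <-]]; rewrite /Rplus /= in_itv /= d_ge0.
have R0 : @Rplus R 0 by rewrite /Rplus /= in_itv /= lexx.
split=> [components Z delta [delta_ultrametric _] Phi [[Psi _ PsiK] _] psi
        [_ psi_incr deltaE]|extendable C C_comp].
- have psi0 : psi 0 = 0.
    have [[_ delta_eq0 _ _] _] := delta_ultrametric.
    by have /delta_eq0 := erefl (Psi x0); rewrite deltaE d0.
  have [g [g_incr gE]] := increasing_extension D_ge0 psi_incr D0 components.
  have g0 : g 0 = 0 by rewrite gE.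
  exists g; split=> //; split=> [t|Y dY dY_ultrametric].
    rewrite /Rplus /= !in_itv /= !andbT le_eqVlt => /orP[/eqP <-|t0].
      by rewrite g0.
    rewrite -g0; apply/ltW/g_incr => //.
    by rewrite /Rplus /= in_itv /= ltW.
  have [[dY_ge0 _ _ _] _] := dY_ultrametric.
  apply: increasing_ultrametric dY_ultrametric _ R0 g0 g_incr => x y.
  by rewrite /Rplus /= in_itv /= dY_ge0.
(* Every strictly increasing [psi] on the distance set with [psi 0 = 0] is the scaling function of
   the identity from [X] with the metric [psi (d x y)], so the hypothesis extends it. *)
- apply: (component_open_or_singleton D_ge0 D0) C_comp => psi psi0 psi_incr.
  pose delta x y := psi (d x y).
  have delta_ultrametric : is_ultrametric delta.
    apply: increasing_ultrametric d_ultrametric _ D0 psi0 psi_incr => x y.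
    by exists x, y.
  have scaling : is_scaling_function delta d id psi.
    by split=> // _ [x [y <-]]; exists x, y.
  have similar : weak_similarity delta d id.
    by split; [exists id|exists psi].
  have [|g [g_incr _ gE]] := extendable X delta _ id similar psi scaling.
    by split=> //; exists id.
  by exists g.
Qed.
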